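(* For each $n\in\mathbb{N}$ and every countable model $M\models\mathrm{I}\Sigma_{n+2}$, there is a proper end extension $K$ of $M$ with $M\preccurlyeq_{\Sigma_{n+2}}K$ and $K\models M\text{-}\mathrm{I}\Sigma_{n+1}$.
   Context: $\mathrm{I}\Sigma_k$ is the induction scheme for $\Sigma_k$ formulas (over $\mathrm{PA}^-$). $M\preccurlyeq_{\Sigma_k}K$: every $\Sigma_k$ formula with parameters from $M$ has the same truth value in $M$ and $K$; end extension: every element of $K\setminus M$ exceeds every element of $M$; proper: $K\neq M$. For an end extension $M\subseteq K$ of models of $\mathrm{I}\Delta_0+\exp$, $K\models M\text{-}\mathrm{I}\Sigma_{n+1}$ means: for every $\Sigma_{n+1}$ formula $\phi(x)$ with parameters from $K$ and every $a\in M$, $K\models\phi(0)\wedge\forall x<a(\phi(x)\to\phi(x+1))\to\forall x<a\,\phi(x)$. *)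

(* Defs.v *)
Inductive term : Type :=
| tvar : nat -> term
| tzero : term
| tone : term
| tadd : term -> term -> term
| tmul : term -> term -> term.

(* Bounded quantifiers [fball t phi] = "forall x < t, phi" and
   [fbex t phi] = "exists x < t, phi": the bound t is interpreted in the
   outer context (so the bound variable x does not occur in t); the body
   phi has the bound variable as de Bruijn index 0. *)
Inductive formula : Type :=
| feq : term -> term -> formula
| flt : term -> term -> formula
| fbot : formula
| fnot : formula -> formula
| fand : formula -> formula -> formula
| forr : formula -> formula -> formula
| fimp : formula -> formula -> formula
| fall : formula -> formula
| fex : formula -> formula
| fball : term -> formula -> formula
| fbex : term -> formula -> formula.

Inductive Delta0 : formula -> Prop :=
| D0_eq : forall s t, Delta0 (feq s t)
| D0_lt : forall s t, Delta0 (flt s t)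
| D0_bot : Delta0 fbot
| D0_not : forall p, Delta0 p -> Delta0 (fnot p)
| D0_and : forall p q, Delta0 p -> Delta0 q -> Delta0 (fand p q)
| D0_or : forall p q, Delta0 p -> Delta0 q -> Delta0 (forr p q)
| D0_imp : forall p q, Delta0 p -> Delta0 q -> Delta0 (fimp p q)
| D0_ball : forall t p, Delta0 p -> Delta0 (fball t p)
| D0_bex : forall t p, Delta0 p -> Delta0 (fbex t p).

Inductive IsSigma : nat -> formula -> Prop :=
| Sig_d0 : forall k p, Delta0 p -> IsSigma k p
| Sig_pi : forall k p, IsPi k p -> IsSigma (S k) p
| Sig_ex : forall k p, IsSigma (S k) p -> IsSigma (S k) (fex p)
with IsPi : nat -> formula -> Prop :=
| Pi_d0 : forall k p, Delta0 p -> IsPi k p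
| Pi_sig : forall k p, IsSigma k p -> IsPi (S k) p
| Pi_all : forall k p, IsPi (S k) p -> IsPi (S k) (fall p).

Record structure : Type := {
  dom :> Type;
  szero : dom;
  sone : dom;
  sadd : dom -> dom -> dom;
  smul : dom -> dom -> dom;
  slt : dom -> dom -> Prop
}.

Definition scons {D : Type} (a : D) (e : nat -> D) : nat -> D :=
  fun i => match i with 0 => a | S j => e j end.

Fixpoint eval (M : structure) (e : nat -> M) (t : term) : M :=
  match t with
  | tvar i => e i
  | tzero => szero M
  | tone => sone M
  | tadd s u => sadd M (eval M e s) (eval M e u)
  | tmul s u => smul M (eval M e s) (eval M e u)
  end.

Fixpoint sat (M : structure) (e : nat -> M) (p : formula) : Prop :=
  match p with
  | feq s t => eval M e s = eval M e t
  | flt s t => slt M (eval M e s) (eval M e t)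
  | fbot => False
  | fnot q => ~ sat M e q
  | fand q r => sat M e q /\ sat M e r
  | forr q r => sat M e q \/ sat M e r
  | fimp q r => sat M e q -> sat M e r
  | fall q => forall a : M, sat M (scons a e) q
  | fex q => exists a : M, sat M (scons a e) q
  | fball t q => forall a : M, slt M a (eval M e t) -> sat M (scons a e) q
  | fbex t q => exists a : M, slt M a (eval M e t) /\ sat M (scons a e) q
  end.

(* PA^- (Kaye): the theory of nonnegative parts of discretely ordered rings. *)
Definition PAminus (M : structure) : Prop :=
  let z := szero M in let o := sone M in
  let ad := sadd M in let mu := smul M in let lt := slt M in
  (forall x y, ad x y = ad y x) /\
  (forall x y w, ad (ad x y) w = ad x (ad y w)) /\
  (forall x y, mu x y = mu y x) /\
  (forall x y w, mu (mu x y) w = mu x (mu y w)) /\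
  (forall x y w, mu x (ad y w) = ad (mu x y) (mu x w)) /\
  (forall x, ad x z = x) /\
  (forall x, mu x z = z) /\
  (forall x, mu x o = x) /\
  (forall x, ~ lt x x) /\
  (forall x y w, lt x y -> lt y w -> lt x w) /\
  (forall x y, lt x y \/ x = y \/ lt y x) /\
  (forall x y w, lt x y -> lt (ad x w) (ad y w)) /\
  (forall x y w, lt z w -> lt x y -> lt (mu x w) (mu y w)) /\
  (forall x y, lt x y -> exists w, ad x w = y) /\
  lt z o /\
  (forall x, lt z x -> (o = x \/ lt o x)) /\
  (forall x, z = x \/ lt z x).

Definition induction_instance (M : structure) (p : formula) (e : nat -> M) : Prop :=
  sat M (scons (szero M) e) p ->
  (forall x : M, sat M (scons x e) p -> sat M (scons (sadd M x (sone M)) e) p) ->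
  forall x : M, sat M (scons x e) p.

Definition ISigma (k : nat) (M : structure) : Prop :=
  PAminus M /\
  forall p, IsSigma k p -> forall e : nat -> M, induction_instance M p e.

Definition countable_structure (M : structure) : Prop :=
  exists g : nat -> M, forall a : M, exists i, g i = a.

Definition embedding (M K : structure) (f : M -> K) : Prop :=
  (forall a b, f a = f b -> a = b) /\
  f (szero M) = szero K /\
  f (sone M) = sone K /\
  (forall a b, f (sadd M a b) = sadd K (f a) (f b)) /\
  (forall a b, f (smul M a b) = smul K (f a) (f b)) /\
  (forall a b, slt M a b <-> slt K (f a) (f b)).

Definition end_ext (M K : structure) (f : M -> K) : Prop :=
  forall k : K, (forall m : M, f m <> k) -> forall m : M, slt K (f m) k.

Definition proper_ext (M K : structure) (f : M -> K) : Prop :=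
  exists k : K, forall m : M, f m <> k.

Definition sigma_elementary (k : nat) (M K : structure) (f : M -> K) : Prop :=
  forall p, IsSigma k p -> forall e : nat -> M,
    sat M e p <-> sat K (fun i => f (e i)) p.

Definition M_ISigma (j : nat) (M K : structure) (f : M -> K) : Prop :=
  forall p, IsSigma j p -> forall (e : nat -> K) (a : M),
    sat K (scons (szero K) e) p ->
    (forall x : K, slt K x (f a) ->
        sat K (scons x e) p -> sat K (scons (sadd K x (sone K)) e) p) ->
    forall x : K, slt K x (f a) -> sat K (scons x e) p.

(* Main.v *)
(* Put m = n + 1.  The model K consists of names c_0, c_1, ... obtained by forcing.
   A condition is a Sigma_m-definable set A of assignments of elements of M to the
   names that is large: the value of c_0 is unbounded in M on A.  A generic sequence
   of conditions decides all Sigma_m formulas about the names, provides witnesses for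
   those it makes true, and gives a name to every element of M.  Truth in K is what is
   forced, for Sigma_m formulas, and half of this equivalence survives one
   quantifier further, which is enough for Sigma_{m+1}-elementarity.

   Given a Sigma_m formula phi(x) about the names and a in M, "A and (for all x < b,
   phi(x)) is large" is a Pi_{m+1} property of b that holds at b = 0.  By induction in M
   either it holds at a, and "for all x < a, phi(x)" can be forced, or there is a last
   b < a where it holds, and then "for all x < b, phi(x)" is forced while not phi(b) is
   forced automatically.  In both cases the induction instance for phi up to a holds
   in K.  For phi(x) := "x < c" the same dichotomy shows that c exceeds a or is equal to
   some b <= a in M, so that K is an end extension of M. *)
From Stdlib Require Import Arith Lia List Cantor Classical ClassicalEpsilon.
From Stdlib Require Import FunctionalExtensionality PropExtensionality.
Require Import Defs.

(** * Extensionality, renaming of variables and finite support of formulas *)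

Lemma pred_ext {A : Type} (X Y : A -> Prop) : (forall a, X a <-> Y a) -> X = Y.
Proof.
  intros H; extensionality a; apply propositional_extensionality, H.
Qed.

(** Equalities of propositions, rather than equivalences, let the facts about [sat] be used as
    rewriting rules. *)
Lemma forall_eq {A : Type} (X Y : A -> Prop) :
  (forall a, X a = Y a) -> (forall a, X a) = (forall a, Y a).
Proof.
  intros H; replace Y with X; [reflexivity | extensionality a; apply H].
Qed.

Lemma exists_eq {A : Type} (X Y : A -> Prop) :
  (forall a, X a = Y a) -> (exists a, X a) = (exists a, Y a).
Proof.
  intros H; replace Y with X; [reflexivity | extensionality a; apply H].
Qed.

Fixpoint tren (f : nat -> nat) (t : term) : term :=
  match t with
  | tvar i => tvar (f i)
  | tzero => tzero
  | tone => tone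
  | tadd s u => tadd (tren f s) (tren f u)
  | tmul s u => tmul (tren f s) (tren f u)
  end.

Definition up (f : nat -> nat) (i : nat) : nat :=
  match i with 0 => 0 | S j => S (f j) end.

Fixpoint ren (f : nat -> nat) (p : formula) : formula :=
  match p with
  | feq s t => feq (tren f s) (tren f t)
  | flt s t => flt (tren f s) (tren f t)
  | fbot => fbot
  | fnot q => fnot (ren f q)
  | fand q r => fand (ren f q) (ren f r)
  | forr q r => forr (ren f q) (ren f r)
  | fimp q r => fimp (ren f q) (ren f r)
  | fall q => fall (ren (up f) q)
  | fex q => fex (ren (up f) q)
  | fball t q => fball (tren f t) (ren (up f) q)
  | fbex t q => fbex (tren f t) (ren (up f) q)
  end.

Lemma eval_tren (M : structure) (e : nat -> M) f t :
  eval M e (tren f t) = eval M (fun i => e (f i)) t.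
Proof. induction t; simpl; congruence. Qed.

Lemma scons_up {D : Type} (a : D) e f :
  (fun i => scons a e (up f i)) = scons a (fun i => e (f i)).
Proof. extensionality i; destruct i; reflexivity. Qed.

Lemma sat_ren (M : structure) p :
  forall (e : nat -> M) f, sat M e (ren f p) = sat M (fun i => e (f i)) p.
Proof.
  induction p; intros e f; simpl; rewrite ?eval_tren, ?IHp, ?IHp1, ?IHp2;
    try reflexivity;
    first [apply forall_eq | apply exists_eq]; intros a;
    rewrite IHp, scons_up; reflexivity.
Qed.

Lemma Delta0_ren p : Delta0 p -> forall f, Delta0 (ren f p).
Proof. induction 1; intros f; simpl; constructor; auto. Qed.

Scheme IsSigma_mut := Induction for IsSigma Sort Prop
  with IsPi_mut := Induction for IsPi Sort Prop.
Combined Scheme IsSigma_IsPi_ind from IsSigma_mut, IsPi_mut.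

Lemma IsSigma_IsPi_ren :
  (forall k p, IsSigma k p -> forall f, IsSigma k (ren f p)) /\
  (forall k p, IsPi k p -> forall f, IsPi k (ren f p)).
Proof.
  apply IsSigma_IsPi_ind; intros; simpl; auto using IsSigma, IsPi, Delta0_ren.
Qed.

Lemma eval_support t : exists N, forall (M : structure) (e e' : nat -> M),
  (forall i, i < N -> e i = e' i) -> eval M e t = eval M e' t.
Proof.
  induction t as [i| | |t1 [N1 H1] t2 [N2 H2]|t1 [N1 H1] t2 [N2 H2]].
  - exists (S i); intros M e e' H; apply H; lia.
  - exists 0; reflexivity.
  - exists 0; reflexivity.
  - exists (N1 + N2); intros M e e' H; simpl.
    rewrite (H1 M e e'), (H2 M e e'); auto; intros; apply H; lia.
  - exists (N1 + N2); intros M e e' H; simpl.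
    rewrite (H1 M e e'), (H2 M e e'); auto; intros; apply H; lia.
Qed.

Lemma scons_agree {D : Type} N (a : D) e e' :
  (forall i, i < N -> e i = e' i) -> forall i, i < N -> scons a e i = scons a e' i.
Proof. intros H [|i] Hi; simpl; [reflexivity | apply H; lia]. Qed.

(** The bound is generous: sums replace maxima, and the shift under a binder is ignored. *)
Lemma sat_support p : exists N, forall (M : structure) (e e' : nat -> M),
  (forall i, i < N -> e i = e' i) -> sat M e p = sat M e' p.
Proof.
  induction p as [s t|s t| |p [N H]|p [N H] q [N' H']|p [N H] q [N' H']
                 |p [N H] q [N' H']|p [N H]|p [N H]|t p [N H]|t p [N H]].
  1, 2: destruct (eval_support s) as [N1 H1], (eval_support t) as [N2 H2];
    exists (N1 + N2); intros M e e' E; simpl;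
    rewrite (H1 M e e'), (H2 M e e'); auto; intros; apply E; lia.
  - exists 0; reflexivity.
  - exists N; intros M e e' E; simpl; rewrite (H M e e'); auto.
  - exists (N + N'); intros M e e' E; simpl;
      rewrite (H M e e'), (H' M e e'); auto; intros; apply E; lia.
  - exists (N + N'); intros M e e' E; simpl;
      rewrite (H M e e'), (H' M e e'); auto; intros; apply E; lia.
  - exists (N + N'); intros M e e' E; simpl;
      rewrite (H M e e'), (H' M e e'); auto; intros; apply E; lia.
  - exists N; intros M e e' E; simpl; apply forall_eq; intros a;
      apply H, scons_agree, E.
  - exists N; intros M e e' E; simpl; apply exists_eq; intros a;
      apply H, scons_agree, E.
  - destruct (eval_support t) as [N1 H1]; exists (N + N1); intros M e e' E; simpl.
    rewrite (H1 M e e') by (intros; apply E; lia).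
    apply forall_eq; intros a; rewrite (H M (scons a e) (scons a e')); auto.
    apply scons_agree; intros; apply E; lia.
  - destruct (eval_support t) as [N1 H1]; exists (N + N1); intros M e e' E; simpl.
    rewrite (H1 M e e') by (intros; apply E; lia).
    apply exists_eq; intros a; rewrite (H M (scons a e) (scons a e')); auto.
    apply scons_agree; intros; apply E; lia.
Qed.

(** * Definable sets of assignments and the arithmetical hierarchy *)

Section Hierarchy.

Context (M : structure).

Local Notation env := (nat -> dom M).
Local Notation "x ⊕ y" := (sadd M x y) (at level 50, left associativity).
Local Notation "x ≺ y" := (slt M x y) (at level 70).

Definition tail (e : env) : env := fun i => e (S i).

(* Each output coordinate is an input coordinate or a constant of [M]:
   this is how variables and constants of [M] are substituted in a formula. *)
Definition subst_map (s : env -> env) : Prop :=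
  forall i, (exists j, forall e, s e i = e j) \/ (exists a, forall e, s e i = a).

Lemma subst_map_comp s s' :
  subst_map s -> subst_map s' -> subst_map (fun e => s (s' e)).
Proof.
  intros H H' i; destruct (H i) as [[j Hj]|[a Ha]].
  - destruct (H' j) as [[l Hl]|[a Ha]].
    + left; exists l; intros e; rewrite Hj; apply Hl.
    + right; exists a; intros e; rewrite Hj; apply Ha.
  - right; exists a; intros e; apply Ha.
Qed.

Lemma subst_map_scons j s :
  subst_map s -> subst_map (fun e => scons (e j) (s e)).
Proof.
  intros H [|i]; simpl; [left; exists j; reflexivity | apply H].
Qed.

Lemma subst_map_const a s :
  subst_map s -> subst_map (fun e => scons a (s e)).
Proof.
  intros H [|i]; simpl; [right; exists a; reflexivity | apply H].
Qed.

Lemma subst_map_vars (r : nat -> nat) : subst_map (fun e i => e (r i)).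
Proof. intros i; left; exists (r i); reflexivity. Qed.

Lemma subst_map_id : subst_map (fun e => e).
Proof. exact (subst_map_vars (fun i => i)). Qed.

Lemma subst_map_tail s : subst_map s -> subst_map (fun e => s (tail e)).
Proof. intros H; apply subst_map_comp; [exact H | apply (subst_map_vars S)]. Qed.

Lemma subst_map_all a : subst_map (fun _ => a).
Proof. intros i; right; exists (a i); reflexivity. Qed.

Hint Resolve subst_map_scons subst_map_const subst_map_vars subst_map_id
  subst_map_tail subst_map_all : subst.

(* Separates the occurrences of coordinate 0, so that it can be bound. *)
Lemma subst_map_bind s : subst_map s ->
  exists f s', subst_map s' /\
    forall a e, s (scons a e) = fun i => scons a (s' e) (f i).
Proof.
  intros H.
  assert (H1 : forall i, exists c : nat * (env -> M),
    ((exists j, forall e, snd c e = e j) \/ (exists a, forall e, snd c e = a)) /\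
    forall a e, s (scons a e) i = scons a (fun _ => snd c e) (fst c)).
  { intros i; destruct (H i) as [[[|j] Hj]|[b Hb]].
    - exists (0, fun e => e 0); simpl; split; [eauto | intros; apply Hj].
    - exists (1, fun e => e j); simpl; split; [eauto | intros; apply Hj].
    - exists (1, fun e => b); simpl; split; [eauto | intros; apply Hb]. }
  pose (c i := proj1_sig (constructive_indefinite_description _ (H1 i))).
  assert (Hc : forall i,
    ((exists j, forall e, snd (c i) e = e j) \/ (exists a, forall e, snd (c i) e = a)) /\
    forall a e, s (scons a e) i = scons a (fun _ => snd (c i) e) (fst (c i))).
  { intros i; exact (proj2_sig (constructive_indefinite_description _ (H1 i))). }
  exists (fun i => match fst (c i) with 0 => 0 | S _ => S i end),
    (fun e i => snd (c i) e); split.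
  - intros i; apply Hc.
  - intros a e; extensionality i; rewrite (proj2 (Hc i)).
    destruct (fst (c i)); reflexivity.
Qed.

(** Constants of [M] enter through [s], so that [p] remains a formula without parameters. *)
Definition D0 (X : env -> Prop) : Prop :=
  exists p s, Delta0 p /\ subst_map s /\ X = fun e => sat M (s e) p.

Lemma D0_sat p s : Delta0 p -> subst_map s -> D0 (fun e => sat M (s e) p).
Proof. intros; exists p, s; auto. Qed.

(** The two substitutions are interleaved: [p] reads the even coordinates and [q] the odd ones. *)
Lemma D0_pair X Y : D0 X -> D0 Y ->
  exists p q s, Delta0 p /\ Delta0 q /\ subst_map s /\
    X = (fun e => sat M (s e) p) /\ Y = fun e => sat M (s e) q.
Proof.
  intros (p & s & Hp & Hs & ->) (q & s' & Hq & Hs' & ->).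
  exists (ren (fun i => 2 * i) p), (ren (fun i => S (2 * i)) q),
    (fun e i => if Nat.even i then s e (Nat.div2 i) else s' e (Nat.div2 i)).
  split; [|split; [|split; [|split]]]; auto using Delta0_ren.
  - intros i; destruct (Nat.even i); auto.
  - extensionality e; rewrite sat_ren; f_equal; extensionality i.
    rewrite Nat.even_even, Nat.div2_double; reflexivity.
  - extensionality e; rewrite sat_ren; f_equal; extensionality i.
    rewrite Nat.even_succ, Nat.odd_even, Nat.div2_succ_double; reflexivity.
Qed.

Lemma D0_and X Y : D0 X -> D0 Y -> D0 (fun e => X e /\ Y e).
Proof.
  intros H H'; destruct (D0_pair X Y H H') as (p & q & s & Hp & Hq & Hs & -> & ->).
  exists (fand p q), s; auto using Delta0.
Qed.

Lemma D0_or X Y : D0 X -> D0 Y -> D0 (fun e => X e \/ Y e).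
Proof.
  intros H H'; destruct (D0_pair X Y H H') as (p & q & s & Hp & Hq & Hs & -> & ->).
  exists (forr p q), s; auto using Delta0.
Qed.

Lemma D0_not X : D0 X -> D0 (fun e => ~ X e).
Proof.
  intros (p & s & Hp & Hs & ->); exists (fnot p), s; auto using Delta0.
Qed.

Lemma D0_ball X j : D0 X -> D0 (fun e => forall a, a ≺ e j -> X (scons a e)).
Proof.
  intros (p & s & Hp & Hs & ->).
  destruct (subst_map_bind s Hs) as (f & s' & Hs' & E).
  (* The bound is put in front as coordinate 0 of the outer assignment; in the body, [up S] keeps
     the quantified variable at 0 and moves all others past the bound. *)
  exists (fball (tvar 0) (ren (fun i => up S (f i)) p)), (fun e => scons (e j) (s' e)).
  split; [auto using Delta0, Delta0_ren | split; [auto with subst|]].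
  extensionality e; simpl; do 2 (apply forall_eq; intro); rewrite sat_ren, E.
  f_equal; extensionality i; destruct (f i); reflexivity.
Qed.

Lemma D0_bex X j : D0 X -> D0 (fun e => exists a, a ≺ e j /\ X (scons a e)).
Proof.
  intros H; apply D0_not, (D0_ball _ j), D0_not in H.
  erewrite pred_ext; [exact H|]; intros e; simpl; split.
  - intros (a & Ha & HX) H'; exact (H' a Ha HX).
  - intros H'; apply NNPP; intros H2; apply H'; intros a Ha HX; eauto.
Qed.

(** Blocks of quantifiers of any length are allowed, as in [IsSigma], which avoids coding pairs in
    [M]. *)
Inductive Ex (C : (env -> Prop) -> Prop) : (env -> Prop) -> Prop :=
| Ex_base : forall X, C X -> Ex C X
| Ex_ex : forall X, Ex C X -> Ex C (fun e => exists a, X (scons a e)).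

(* [Sg k X]: the set [X] of assignments is Sigma_k-definable in [M] with
   constants of [M]; Pi_k sets are those whose complement satisfies [Sg k]. *)
Fixpoint Sg (k : nat) : (env -> Prop) -> Prop :=
  match k with
  | 0 => D0
  | S k => Ex (fun X => Sg k (fun e => ~ X e))
  end.

Lemma not_not_pred (X : env -> Prop) : (fun e => ~ ~ X e) = X.
Proof. apply pred_ext; intros e; split; [apply NNPP | auto]. Qed.

Lemma Sg_co k X : Sg k (fun e => ~ X e) -> Sg (S k) X.
Proof. intros H; apply Ex_base, H. Qed.

Lemma Sg_not k X : Sg k X -> Sg (S k) (fun e => ~ X e).
Proof. intros H; apply Sg_co; rewrite not_not_pred; exact H. Qed.

Lemma Sg_ex k X : Sg (S k) X -> Sg (S k) (fun e => exists a, X (scons a e)).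
Proof. apply Ex_ex. Qed.

Lemma Sg_subst k : forall X s, Sg k X -> subst_map s -> Sg k (fun e => X (s e)).
Proof.
  induction k as [|k IH]; intros X s HX Hs.
  - destruct HX as (p & s' & Hp & Hs' & ->).
    exists p, (fun e => s' (s e)); auto using subst_map_comp.
  - revert s Hs; induction HX as [X HX|X HX IHX]; intros s Hs.
    + apply Ex_base, (IH (fun e => ~ X e)); assumption.
    + apply (Ex_ex _ (fun e => X (scons (e 0) (s (tail e))))).
      apply (IHX (fun e => scons (e 0) (s (tail e)))); auto with subst.
Qed.

Lemma Sg_tail k X : Sg k X -> Sg k (fun e => X (tail e)).
Proof. intros H; apply (Sg_subst k X tail H), (subst_map_vars S). Qed.

Lemma D0_Sg k : forall X, D0 X -> Sg k X.
Proof.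
  induction k as [|k IH]; intros X H; [exact H | apply Sg_co, IH, D0_not, H].
Qed.

Lemma Sg_succ k : forall X, Sg k X -> Sg (S k) X.
Proof.
  induction k as [|k IH]; intros X H; [apply D0_Sg, H|].
  induction H as [X H|X H IHX]; [apply Sg_co, IH, H | apply Sg_ex, IHX].
Qed.

Lemma Sg_le k k' X : k <= k' -> Sg k X -> Sg k' X.
Proof. induction 1; auto using Sg_succ. Qed.

(** Conjunction and disjunction are treated together because passing to complements exchanges them.
    Quantifiers are pulled out one at a time, the other set being moved to [tail]. *)
Lemma Sg_and_or k :
  (forall X Y, Sg k X -> Sg k Y -> Sg k (fun e => X e /\ Y e)) /\
  (forall X Y, Sg k X -> Sg k Y -> Sg k (fun e => X e \/ Y e)).
Proof.
  induction k as [|k [IHa IHo]]; [split; [apply D0_and | apply D0_or]|].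
  split; intros X Y HX; revert Y; induction HX as [X HX|X HX IHX]; intros Y HY.
  - revert X HX; induction HY as [Y HY|Y HY IHY]; intros X HX.
    + apply Sg_co; erewrite pred_ext; [apply (IHo _ _ HX HY)|].
      intros e; simpl; split; [apply not_and_or | tauto].
    + specialize (IHY (fun e => X (tail e)) (Sg_tail k _ HX)).
      erewrite pred_ext; [apply (Ex_ex _ _ IHY)|]; intros e; simpl; split.
      * intros [H [a H']]; exists a; auto.
      * intros [a [H H']]; split; [exact H | exists a; exact H'].
  - specialize (IHX _ (Sg_tail (S k) _ HY)).
    erewrite pred_ext; [apply (Ex_ex _ _ IHX)|]; intros e; simpl; split.
    + intros [[a H] H']; exists a; auto.
    + intros [a [H H']]; split; [exists a; exact H | exact H'].
  - revert X HX; induction HY as [Y HY|Y HY IHY]; intros X HX.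
    + apply Sg_co; erewrite pred_ext; [apply (IHa _ _ HX HY)|].
      intros e; simpl; tauto.
    + specialize (IHY (fun e => X (tail e)) (Sg_tail k _ HX)).
      erewrite pred_ext; [apply (Ex_ex _ _ IHY)|]; intros e; simpl; split.
      * intros [H | [a H]]; [exists (szero M) | exists a]; auto.
      * intros [a [H | H]]; [left; exact H | right; exists a; exact H].
  - specialize (IHX _ (Sg_tail (S k) _ HY)).
    erewrite pred_ext; [apply (Ex_ex _ _ IHX)|]; intros e; simpl; split.
    + intros [[a H] | H]; [exists a | exists (szero M)]; auto.
    + intros [a [H | H]]; [left; exists a; exact H | right; exact H].
Qed.

Lemma Sg_and k X Y : Sg k X -> Sg k Y -> Sg k (fun e => X e /\ Y e).
Proof. apply Sg_and_or. Qed.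

Lemma Sg_or k X Y : Sg k X -> Sg k Y -> Sg k (fun e => X e \/ Y e).
Proof. apply Sg_and_or. Qed.

(** This provides fresh coordinates for Henkin witnesses and reduces quantification over assignments
    to finitely many quantifiers. *)
Lemma Sg_support k : forall X, Sg k X ->
  exists N, forall e e', (forall i, i < N -> e i = e' i) -> X e -> X e'.
Proof.
  induction k as [|k IH]; intros X H.
  - destruct H as (p & s & Hp & Hs & ->).
    destruct (sat_support p) as [N HN].
    assert (B : exists N', forall e e', (forall i, i < N' -> e i = e' i) ->
              forall i, i < N -> s e i = s e' i).
    { clear HN; induction N as [|N [N' IHN]].
      - exists 0; intros; lia.
      - destruct (Hs N) as [[j Hj]|[a Ha]].
        + exists (N' + S j); intros e e' E i Hi.
          destruct (Nat.eq_dec i N) as [->|Hn].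
          * rewrite !Hj; apply E; lia.
          * apply IHN; [intros; apply E|]; lia.
        + exists N'; intros e e' E i Hi.
          destruct (Nat.eq_dec i N) as [->|Hn].
          * rewrite !Ha; reflexivity.
          * apply IHN; [intros; apply E|]; lia. }
    destruct B as [N' B]; exists N'; intros e e' E.
    rewrite (HN M _ _ (B e e' E)); auto.
  - induction H as [X H|X H [N IHX]].
    + destruct (IH _ H) as [N HN]; exists N; intros e e' E HX.
      apply NNPP; intros HX'; apply (HN e' e); auto.
      intros; symmetry; auto.
    + exists N; intros e e' E [a Ha]; exists a.
      apply (IHX (scons a e)); [apply scons_agree, E | exact Ha].
Qed.

Lemma Sg_of_formula :
  (forall k p, IsSigma k p -> forall s, subst_map s -> Sg k (fun e => sat M (s e) p)) /\
  (forall k p, IsPi k p -> forall s, subst_map s -> Sg k (fun e => ~ sat M (s e) p)).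
Proof.
  apply IsSigma_IsPi_ind.
  - intros k p Hp s Hs; apply D0_Sg, D0_sat; assumption.
  - intros k p Hp IH s Hs; apply Sg_co, IH, Hs.
  - intros k p Hp IH s Hs.
    apply (Sg_ex k (fun e => sat M (scons (e 0) (s (tail e))) p)).
    apply (IH (fun e => scons (e 0) (s (tail e)))); auto with subst.
  - intros k p Hp s Hs; apply D0_Sg, D0_not, D0_sat; assumption.
  - intros k p Hp IH s Hs; apply Sg_not, IH, Hs.
  - intros k p Hp IH s Hs.
    assert (H : Sg (S k) (fun e => ~ sat M (scons (e 0) (s (tail e))) p)).
    { apply (IH (fun e => scons (e 0) (s (tail e)))); auto with subst. }
    apply Sg_ex in H; erewrite pred_ext; [exact H|]; intros e; simpl; split.
    + apply not_all_ex_not.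
    + intros [a Ha] H'; exact (Ha (H' a)).
Qed.

(** The converse of [Sg_of_formula]. It carries the induction scheme, which speaks of prenex
    formulas only, over to sets obtained by Boolean operations and bounded quantifiers. The Pi half
    is what the induction on [k] needs for complements. *)
Lemma formula_of_Sg k : forall X, Sg k X ->
  (exists p s, IsSigma k p /\ subst_map s /\ X = fun e => sat M (s e) p) /\
  (exists p s, IsPi k p /\ subst_map s /\ (fun e => ~ X e) = fun e => sat M (s e) p).
Proof.
  induction k as [|k IH]; intros X H.
  - destruct H as (p & s & Hp & Hs & ->); split.
    + exists p, s; auto using IsSigma.
    + exists (fnot p), s; auto using IsPi, Delta0.
  - induction H as [X H|X H [(p & s & Hp & Hs & Ep) (q & s' & Hq & Hs' & Eq)]].
    + destruct (IH _ H) as [(p & s & Hp & Hs & Ep) (q & s' & Hq & Hs' & Eq)].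
      rewrite not_not_pred in Eq; split.
      * exists q, s'; auto using IsSigma.
      * exists p, s; auto using IsPi.
    + split.
      * destruct (subst_map_bind s Hs) as (f & s2 & Hs2 & E).
        exists (fex (ren f p)), s2; split; [|split; [exact Hs2|]].
        -- apply Sig_ex, IsSigma_IsPi_ren, Hp.
        -- rewrite Ep; extensionality e; simpl; apply exists_eq; intros a.
           rewrite E, sat_ren; reflexivity.
      * destruct (subst_map_bind s' Hs') as (f & s2 & Hs2 & E).
        exists (fall (ren f q)), s2; split; [|split; [exact Hs2|]].
        -- apply Pi_all, IsSigma_IsPi_ren, Hq.
        -- apply pred_ext; intros e; simpl.
           assert (E' : forall a, sat M (scons a (s2 e)) (ren f q) = ~ X (scons a e)).
           { intros a; rewrite sat_ren, <- E.
             exact (eq_sym (f_equal (fun Z => Z (scons a e)) Eq)). }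
           split.
           ++ intros H' a; rewrite E'; eauto.
           ++ intros H' [a Ha]; specialize (H' a); rewrite E' in H'; auto.
Qed.

(** * Order and addition in PA^- *)

Context (HPA : PAminus M).

Lemma lt_irrefl x : ~ x ≺ x.
Proof. unfold PAminus in HPA; cbv zeta in HPA; intuition eauto. Qed.
Lemma lt_trans x y z : x ≺ y -> y ≺ z -> x ≺ z.
Proof. destruct HPA as (_&_&_&_&_&_&_&_&_&H&_); apply H. Qed.
Lemma lt_trichotomy x y : x ≺ y \/ x = y \/ y ≺ x.
Proof. destruct HPA as (_&_&_&_&_&_&_&_&_&_&H&_); apply H. Qed.
Lemma add_comm x y : x ⊕ y = y ⊕ x.
Proof. destruct HPA as (H&_); apply H. Qed.
Lemma add_assoc x y z : x ⊕ y ⊕ z = x ⊕ (y ⊕ z).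
Proof. destruct HPA as (_&H&_); apply H. Qed.
Lemma add_0 x : x ⊕ szero M = x.
Proof. destruct HPA as (_&_&_&_&_&H&_); apply H. Qed.
Lemma lt_add x y z : x ≺ y -> x ⊕ z ≺ y ⊕ z.
Proof. destruct HPA as (_&_&_&_&_&_&_&_&_&_&_&H&_); apply H. Qed.
Lemma lt_sub x y : x ≺ y -> exists z, x ⊕ z = y.
Proof. destruct HPA as (_&_&_&_&_&_&_&_&_&_&_&_&_&H&_); apply H. Qed.
Lemma lt_0_1 : szero M ≺ sone M.
Proof. destruct HPA as (_&_&_&_&_&_&_&_&_&_&_&_&_&_&H&_); apply H. Qed.
Lemma one_least x : szero M ≺ x -> sone M = x \/ sone M ≺ x.
Proof. destruct HPA as (_&_&_&_&_&_&_&_&_&_&_&_&_&_&_&H&_); apply H. Qed.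
Lemma zero_or_pos x : szero M = x \/ szero M ≺ x.
Proof. destruct HPA as (_&_&_&_&_&_&_&_&_&_&_&_&_&_&_&_&H); apply H. Qed.

Lemma lt_add_l x y z : x ≺ y -> z ⊕ x ≺ z ⊕ y.
Proof. rewrite !(add_comm z); apply lt_add. Qed.

Lemma lt_succ x : x ≺ x ⊕ sone M.
Proof. rewrite <- (add_0 x) at 1; apply lt_add_l, lt_0_1. Qed.

Lemma not_lt_0 x : ~ x ≺ szero M.
Proof.
  intros H; destruct (zero_or_pos x) as [<-|H'].
  - exact (lt_irrefl _ H).
  - exact (lt_irrefl _ (lt_trans _ _ _ H H')).
Qed.

Lemma lt_succ_inv x y : x ≺ y ⊕ sone M -> x ≺ y \/ x = y.
Proof.
  intros H; destruct (lt_trichotomy x y) as [H1|[H1|H1]]; auto; exfalso.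
  destruct (lt_sub _ _ H1) as [w <-].
  destruct (zero_or_pos w) as [<-|Hw].
  - rewrite add_0 in H1; exact (lt_irrefl _ H1).
  - destruct (one_least w Hw) as [<-|H2]; [exact (lt_irrefl _ H)|].
    exact (lt_irrefl _ (lt_trans _ _ _ H (lt_add_l _ _ y H2))).
Qed.

Lemma zero_or_succ x : x = szero M \/ exists y, x = y ⊕ sone M.
Proof.
  destruct (zero_or_pos x) as [<-|H]; auto; right.
  destruct (one_least x H) as [<-|H1].
  - exists (szero M); rewrite add_comm, add_0; reflexivity.
  - destruct (lt_sub _ _ H1) as [w <-]; exists w; apply add_comm.
Qed.

(** The weak order is expressed by negation: [~ y ≺ x] stands for x being at most y. *)
Lemma not_lt_add x y : ~ x ⊕ y ≺ x.
Proof.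
  intros H; destruct (zero_or_pos y) as [<-|Hy].
  - rewrite add_0 in H; exact (lt_irrefl _ H).
  - apply (lt_add_l _ _ x) in Hy; rewrite add_0 in Hy.
    exact (lt_irrefl _ (lt_trans _ _ _ H Hy)).
Qed.

Lemma not_lt_trans x y z : ~ y ≺ x -> y ≺ z -> x ≺ z.
Proof.
  intros H H'; destruct (lt_trichotomy x y) as [H1|[->|H1]]; [|exact H'|contradiction].
  exact (lt_trans _ _ _ H1 H').
Qed.

Lemma lt_not_lt_trans x y z : x ≺ y -> ~ z ≺ y -> x ≺ z.
Proof.
  intros H H'; destruct (lt_trichotomy y z) as [H1|[->|H1]]; [|exact H|contradiction].
  exact (lt_trans _ _ _ H H1).
Qed.

Lemma upper_bound x y : exists z, x ≺ z /\ y ≺ z.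
Proof.
  exists (x ⊕ y ⊕ sone M); split.
  - apply (not_lt_trans _ (x ⊕ y)); [apply not_lt_add | apply lt_succ].
  - apply (not_lt_trans _ (x ⊕ y)); [rewrite add_comm; apply not_lt_add | apply lt_succ].
Qed.

(** * Induction, collection and bounded quantifiers for definable sets *)

Context (l : nat) (Hind : forall p, IsSigma (S l) p -> forall e : env, induction_instance M p e).

Lemma Sg_induction k X e : k <= S l -> Sg k X ->
  X (scons (szero M) e) ->
  (forall x, X (scons x e) -> X (scons (x ⊕ sone M) e)) ->
  forall x, X (scons x e).
Proof.
  intros Hk HX; apply (Sg_le k (S l)) in HX; [|exact Hk].
  destruct (formula_of_Sg (S l) X HX) as [(p & s & Hp & Hs & E) _].
  destruct (subst_map_bind s Hs) as (f & s' & Hs' & Es).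
  assert (EX : forall a, X (scons a e) = sat M (scons a (s' e)) (ren f p)).
  { intros a; rewrite E, Es, sat_ren; reflexivity. }
  intros H0 H1 x; rewrite EX; apply (Hind (ren f p)).
  - apply IsSigma_IsPi_ren, Hp.
  - rewrite <- EX; exact H0.
  - intros y; rewrite <- !EX; apply H1.
Qed.

Lemma D0_lt i j : D0 (fun e => e i ≺ e j).
Proof.
  apply (D0_sat (flt (tvar i) (tvar j)) (fun e => e)); auto using Delta0 with subst.
Qed.

Definition bounded_closed (C : (env -> Prop) -> Prop) : Prop :=
  (forall X j, C X -> C (fun e => forall a, a ≺ e j -> X (scons a e))) /\
  (forall X j, C X -> C (fun e => exists a, a ≺ e j /\ X (scons a e))).

Lemma bounded_closed_co C : bounded_closed C ->
  bounded_closed (fun X => C (fun e => ~ X e)).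
Proof.
  intros [H1 H2]; split; intros X j H.
  - apply (H2 _ j) in H; erewrite pred_ext; [exact H|]; intros e; simpl; split.
    + intros H'; apply NNPP; intros H3; apply H'; intros a Ha; apply NNPP; eauto.
    + intros (a & Ha & H3) H'; auto.
  - apply (H1 _ j) in H; erewrite pred_ext; [exact H|]; intros e; simpl; split.
    + intros H' a Ha H3; eauto.
    + intros H' (a & Ha & H3); exact (H' a Ha H3).
Qed.

(* A block of existential quantifiers is contracted to one by bounding it. *)
Lemma Sg_normal_form k X : bounded_closed (Sg k) -> Sg (S k) X ->
  exists Z, Sg k (fun e => ~ Z e) /\ X = fun e => exists t, Z (scons t e).
Proof.
  intros B H; apply bounded_closed_co in B; destruct B as [_ B].
  induction H as [X H|X H (Z & HZ & ->)].
  - exists (fun e => X (tail e)); split; [apply (Sg_tail k _ H)|].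
    apply pred_ext; intros e; split.
    + intros HX; exists (szero M); exact HX.
    + intros [t HX]; exact HX.
  - exists (fun e => exists a, a ≺ e 0 /\
              exists t, t ≺ e 0 /\ Z (scons t (scons a (tail e)))); split.
    + apply (B (fun e => exists t, t ≺ e 1 /\ Z (scons t (scons (e 0) (tail (tail e))))) 0).
      apply (B (fun e => Z (scons (e 0) (scons (e 1) (tail (tail (tail e)))))) 1).
      apply (Sg_subst k _ (fun e => scons (e 0) (scons (e 1) (tail (tail (tail e)))))
              HZ).
      apply subst_map_scons, subst_map_scons.
      apply (subst_map_vars (fun i => S (S (S i)))).
    + apply pred_ext; intros e; split.
      * intros (a & t & H'); destruct (upper_bound a t) as (b & Ha & Ht).
        exists b, a; split; [exact Ha | exists t; split; [exact Ht | exact H']].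
      * intros (b & a & _ & t & _ & H'); exists a, t; exact H'.
Qed.

(** Induction on [b]. As Pi_k sets are closed under bounded quantifiers, the existence of a common
    bound [u] below [b] is a Sigma_{k+1} property of [b]; in the successor step [u] is enlarged past
    one more witness. *)
Lemma collection k Z e : bounded_closed (Sg k) -> S k <= S l ->
  Sg k (fun e => ~ Z e) ->
  (forall a, exists t, Z (scons t (scons a e))) ->
  forall b, exists u, forall a, a ≺ b -> exists t, t ≺ u /\ Z (scons t (scons a e)).
Proof.
  intros B Hk HZ H.
  apply bounded_closed_co in B; destruct B as [B1 B2].
  apply (Sg_induction (S k) (fun e => exists u, forall a, a ≺ e 0 ->
           exists t, t ≺ u /\ Z (scons t (scons a (tail e)))) e Hk).
  - apply (Sg_ex k (fun e => forall a, a ≺ e 1 ->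
             exists t, t ≺ e 0 /\ Z (scons t (scons a (tail (tail e)))))).
    apply Sg_co.
    (* Each quantifier pushes a coordinate: innermost, 0 is t, 1 is a, 2 is u and 3 is the induction
       variable. *)
    apply (B1 (fun e => exists t, t ≺ e 1 /\
                 Z (scons t (scons (e 0) (tail (tail (tail e)))))) 1).
    apply (B2 (fun e => Z (scons (e 0) (scons (e 1) (tail (tail (tail (tail e))))))) 1).
    apply (Sg_subst k _ (fun e => scons (e 0) (scons (e 1) (tail (tail (tail (tail e))))))
            HZ).
    apply subst_map_scons, subst_map_scons.
    apply (subst_map_vars (fun i => S (S (S (S i))))).
  - exists (szero M); intros a Ha; destruct (not_lt_0 _ Ha).
  - intros x (u & Hu); destruct (H x) as [t0 Ht0].
    destruct (upper_bound u t0) as (v & Huv & Htv).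
    exists v; simpl; intros a Ha; destruct (lt_succ_inv _ _ Ha) as [Ha'| ->].
    + destruct (Hu a Ha') as (t & Ht & HZt); exists t; split; [|exact HZt].
      exact (lt_trans _ _ _ Ht Huv).
    + exists t0; split; [exact Htv | exact Ht0].
Qed.

(** By induction on [k]. A bounded existential quantifier merges with the leading ones; a bounded
    universal quantifier is moved inside the leading existential one by collection for the Pi_k
    matrix. *)
Lemma Sg_bounded k : k <= S l -> bounded_closed (Sg k).
Proof.
  induction k as [|k IH]; intros Hk; [split; [apply D0_ball | apply D0_bex]|].
  specialize (IH (Nat.le_trans _ _ _ (Nat.le_succ_diag_r k) Hk)); split; intros X j HX.
  - destruct (Sg_normal_form k X IH HX) as (Z & HZ & ->).
    pose proof (bounded_closed_co _ IH) as [B1 B2].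
    erewrite pred_ext;
      [apply (Sg_ex k (fun e => forall a, a ≺ e (S j) ->
             exists t, t ≺ e 0 /\ Z (scons t (scons a (tail e)))))|].
    + apply Sg_co.
      apply (B1 (fun e => exists t, t ≺ e 1 /\
                   Z (scons t (scons (e 0) (tail (tail e))))) (S j)).
      apply (B2 (fun e => Z (scons (e 0) (scons (e 1) (tail (tail (tail e)))))) 1).
      apply (Sg_subst k _ (fun e => scons (e 0) (scons (e 1) (tail (tail (tail e)))))
              HZ).
      apply subst_map_scons, subst_map_scons.
      apply (subst_map_vars (fun i => S (S (S i)))).
    + intros e; split.
      * intros H.
        (* Collection asks for a witness at every [a], so the matrix is made trivially true for [a]
           outside the bound; there 0 serves as witness. Coordinate 1 is [a], and the bound [e j]
           has moved to [S (S j)]. *)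
        destruct (collection k (fun e => ~ e 1 ≺ e (S (S j)) \/ Z e) e IH Hk) with (b := e j)
          as [u Hu].
        -- erewrite pred_ext; [apply (Sg_and k _ _ (D0_Sg k _ (D0_lt 1 (S (S j)))) HZ)|].
           intros e'; simpl; split; [intros H' | tauto].
           apply not_or_and in H'; split; [apply NNPP|]; tauto.
        -- intros a; destruct (classic (a ≺ e j)) as [Ha|Ha].
           ++ destruct (H a Ha) as [t Ht]; exists t; right; exact Ht.
           ++ exists (szero M); left; exact Ha.
        -- exists u; intros a Ha; destruct (Hu a Ha) as (t & Ht & [H'|H']).
           ++ destruct (H' Ha).
           ++ exists t; split; [exact Ht | exact H'].
      * intros [u Hu] a Ha; destruct (Hu a Ha) as (t & _ & Ht); exists t; exact Ht.
  - apply (Sg_ex k (fun e => e 0 ≺ e (S j) /\ X e)).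
    apply (Sg_and (S k) (fun e => e 0 ≺ e (S j))); [apply D0_Sg, D0_lt | exact HX].
Qed.

(* Counting down from [a] reduces this to induction for a Sigma_{l+1} set. *)
Lemma Sg_change_below X e a : Sg (S l) X ->
  ~ X (scons (szero M) e) -> X (scons a e) ->
  exists b, b ≺ a /\ ~ X (scons b e) /\ X (scons (b ⊕ sone M) e).
Proof.
  intros HX H0 Ha; apply NNPP; intros Hn.
  (* The invariant for x steps: some y with x + y at most [a] lies in X, unless x has passed [a].
     Such a y is not 0, and its predecessor is again in X, since otherwise it would be the change
     sought. At x = [a] only y = 0 remains, which is excluded. *)
  assert (HQ : a ≺ a \/ exists y, ~ a ≺ a ⊕ y /\ X (scons y e)).
  { apply (Sg_induction (S l) (fun e => a ≺ e 0 \/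
             exists y, ~ a ≺ e 0 ⊕ y /\ X (scons y (tail e))) e (le_n (S l))).
    - apply (Sg_or (S l) (fun e => a ≺ e 0)).
      + apply D0_Sg, (D0_sat (flt (tvar 0) (tvar 1)) (fun e => scons a (fun _ => e 0)));
          auto using Delta0.
        intros [|i]; simpl; eauto.
      + assert (H : Sg (S l) (fun e => ~ a ≺ e 1 ⊕ e 0 /\ X (scons (e 0) (tail (tail e))))).
        { apply (Sg_and (S l) (fun e => ~ a ≺ e 1 ⊕ e 0)).
          - apply D0_Sg, D0_not, (D0_sat (flt (tvar 0) (tadd (tvar 2) (tvar 1)))
              (fun e => scons a e)); auto using Delta0 with subst.
          - apply (Sg_subst (S l) X (fun e => scons (e 0) (tail (tail e))) HX).
            apply subst_map_scons, (subst_map_vars (fun i => S (S i))). }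
        exact (Sg_ex l _ H).
    - right; exists a; split; [simpl; rewrite add_comm, add_0; apply lt_irrefl | exact Ha].
    - intros x [H|(y & H & HXy)]; simpl in *.
      + left; exact (lt_trans _ _ _ H (lt_succ x)).
      + destruct (zero_or_succ y) as [->|(z & ->)]; [contradiction|].
        right; exists z; split.
        * rewrite add_assoc, (add_comm _ z); exact H.
        * apply NNPP; intros HXz; apply Hn; exists z; split; [|auto].
          apply NNPP; intros Hz; apply H.
          apply (not_lt_trans _ z _ Hz), (lt_not_lt_trans _ _ _ (lt_succ z)).
          rewrite add_comm; apply not_lt_add. }
  destruct HQ as [H|(y & H & HXy)]; [exact (lt_irrefl _ H)|].
  destruct (zero_or_pos y) as [<-|Hy]; [contradiction|].
  apply H; apply (lt_add_l _ _ a) in Hy; rewrite add_0 in Hy; exact Hy.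
Qed.

(** * Quantification over assignments, and large sets *)

Definition env_app (N : nat) (e' e : env) : env :=
  fun i => if i <? N then e' i else e (i - N).

Lemma Sg_ex_block k N : forall X, Sg (S k) X ->
  Sg (S k) (fun e => exists e', X (env_app N e' e)).
Proof.
  induction N as [|N IH]; intros X HX.
  - erewrite pred_ext; [exact HX|]; intros e; simpl.
    assert (E : forall e', env_app 0 e' e = e).
    { intros e'; extensionality i; unfold env_app; simpl; f_equal; lia. }
    split; [intros [e' H]; rewrite E in H; exact H|].
    intros H; exists e; rewrite E; exact H.
  - erewrite pred_ext; [apply (IH _ (Sg_ex k X HX))|]; intros e; simpl.
    assert (E : forall a e', scons a (env_app N e' e) = env_app (S N) (scons a e') e).
    { intros a e'; extensionality i; destruct i; reflexivity. }
    split.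
    + intros [e' H]; exists (tail e'), (e' 0); rewrite E.
      replace (scons (e' 0) (tail e')) with e'; [exact H|].
      extensionality i; destruct i; reflexivity.
    + intros (e' & a & H); exists (scons a e'); rewrite <- E; exact H.
Qed.

(* Quantification over whole assignments is a finite block by [Sg_support]. *)
Lemma Sg_ex_env k X : Sg (S k) X ->
  Sg (S k) (fun e => exists e', X (scons (e 1) (scons (e 0) e'))).
Proof.
  intros HX; destruct (Sg_support _ X HX) as [N HN].
  (* Behind a quantified block of length [N], the parameters [e 0] and [e 1] are found at [N] and
     [S N]. *)
  assert (H : Sg (S k) (fun w => X (scons (w (S N)) (scons (w N) w)))).
  { apply (Sg_subst (S k) X (fun w => scons (w (S N)) (scons (w N) w)) HX).
    auto with subst. }
  apply (Sg_ex_block k N) in H; erewrite pred_ext; [exact H|]; intros e; simpl.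
  assert (E : forall e', env_app N e' e N = e 0 /\ env_app N e' e (S N) = e 1).
  { intros e'; unfold env_app; rewrite Nat.ltb_irrefl, Nat.sub_diag.
    destruct (Nat.ltb_spec (S N) N); [lia|]; split; [|f_equal; lia]; reflexivity. }
  assert (E' : forall e' i, i < N -> env_app N e' e i = e' i).
  { intros e' i Hi; unfold env_app; apply Nat.ltb_lt in Hi; rewrite Hi; reflexivity. }
  assert (A : forall e' i, i < N ->
    scons (e 1) (scons (e 0) e') i = scons (e 1) (scons (e 0) (env_app N e' e)) i).
  { intros e' [|[|i]] Hi; simpl; auto; symmetry; apply E'; lia. }
  split; intros [e' H']; exists e'; destruct (E e') as [E0 E1].
  - rewrite E0, E1; exact (HN _ _ (A e') H').
  - rewrite E0, E1 in H'; refine (HN _ _ _ H'); intros; symmetry; apply A; assumption.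
Qed.

(* Coordinate 0 of a generic assignment will be the element above [M]. *)
Definition large (A : env -> Prop) : Prop := forall u, exists e, u ≺ e 0 /\ A e.

Lemma large_mono (A B : env -> Prop) : (forall e, A e -> B e) -> large A -> large B.
Proof. intros H HA u; destruct (HA u) as (e & Hu & He); eauto. Qed.

Lemma not_large A : ~ large A -> exists u, forall e, u ≺ e 0 -> ~ A e.
Proof.
  intros H; apply not_all_ex_not in H; destruct H as [u Hu].
  exists u; intros e He HA; apply Hu; eauto.
Qed.

End Hierarchy.

Arguments tail {M} e.
Arguments subst_map {M} s.
Arguments large {M} A.

(** * Conditions and the generic filter *)

Section Generic.

Context (M : structure) (n : nat) (HPA : PAminus M).
Context (Hind : forall p, IsSigma (S (S n)) p -> forall e, induction_instance M p e).

Local Notation env := (nat -> dom M).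
Local Notation "x ≺ y" := (slt M x y) (at level 70).

(** Largeness quantifies universally over u and then existentially over an assignment, so its
    failure [P] is Sigma_{n+2} in b. It fails to fail at 0, where the bounded statement is vacuous,
    and [Sg_change_below] locates the change. This is where the induction of [M] at level n+2
    enters. *)
Lemma large_cut A X a : Sg M (S n) A -> Sg M (S n) X -> large A ->
  large (fun e => A e /\ forall x, x ≺ a -> X (scons x e)) \/
  exists b, b ≺ a /\ large (fun e => A e /\ forall x, x ≺ b -> X (scons x e)) /\
    ~ large (fun e => A e /\ forall x, x ≺ sadd M b (sone M) -> X (scons x e)).
Proof.
  intros HA HX Hl.
  destruct (classic (large (fun e => A e /\ forall x, x ≺ a -> X (scons x e))))
    as [H|H]; [left; exact H | right].
  pose (P w := ~ large (fun e => A e /\ forall x, x ≺ w 0 -> X (scons x e))).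
  assert (HP : Sg M (S (S n)) P).
  { erewrite pred_ext;
      (* Here [w 0] is the bound u witnessing that the set is not large, and [w 1] is b. *)
      [apply (Sg_ex M (S n) (fun w => ~ exists e', w 0 ≺ e' 0 /\ A e' /\
         forall x, x ≺ w 1 -> X (scons x e')))|].
    - apply Sg_not.
      apply (Sg_ex_env M n (fun w => w 1 ≺ w 2 /\ A (tail (tail w)) /\
               forall x, x ≺ w 0 -> X (scons x (tail (tail w))))).
      apply Sg_and; [apply D0_Sg, D0_lt | apply Sg_and].
      + do 2 apply (Sg_tail M (S n)) in HA; exact HA.
      + apply (proj1 (Sg_bounded M HPA (S n) Hind (S n) (Nat.le_succ_diag_r _))
                 (fun w => X (scons (w 0) (tail (tail (tail w))))) 0).
        apply (Sg_subst M (S n) X (fun w => scons (w 0) (tail (tail (tail w)))) HX).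
        apply subst_map_scons, (subst_map_vars M (fun i => S (S (S i)))).
    - intros w; split.
      + intros H'; apply not_all_ex_not in H'; exact H'.
      + intros [u Hu] H'; exact (Hu (H' u)). }
  destruct (Sg_change_below M HPA (S n) Hind P (fun _ => szero M) a HP) as (b & Hb & H1 & H2).
  - intros H'; apply H'; refine (large_mono M A _ _ Hl).
    intros e He; split; [exact He|]; intros x Hx; destruct (not_lt_0 M HPA _ Hx).
  - exact H.
  - exists b; split; [exact Hb | split; [apply NNPP, H1 | exact H2]].
Qed.

Record condition := {
  cset :> env -> Prop;
  cset_Sg : Sg M (S n) cset;
  cset_large : large cset
}.

Definition update (e : env) (N : nat) (a : M) : env :=
  fun i => if i =? N then a else e i.

(** A coordinate outside the supports of [A] and [X] can be overwritten by the witness without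
    affecting membership in either, so it can serve as a name for the witness. *)
Lemma henkin_extension (A : condition) X : Sg M (S n) X ->
  large (fun e => A e /\ exists a, X (scons a e)) ->
  exists A' : condition, (forall e, A' e -> A e) /\
    exists j, forall e, A' e -> X (scons (e j) e).
Proof.
  intros HX Hl.
  destruct (Sg_support M _ A (cset_Sg A)) as [N HN].
  destruct (Sg_support M _ X HX) as [N' HN'].
  (* The successor keeps [j] away from coordinate 0, on which largeness depends. *)
  pose (j := S (N + N')).
  assert (HS : Sg M (S n) (fun e => A e /\ X (scons (e j) e))).
  { apply Sg_and; [apply A|].
    apply (Sg_subst M (S n) X (fun e => scons (e j) e) HX).
    apply subst_map_scons, subst_map_id. }
  assert (HL : large (fun e => A e /\ X (scons (e j) e))).
  { intros u; destruct (Hl u) as (e & Hu & HA & a & Ha).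
    assert (E : forall i, i < j -> e i = update e j a i).
    { intros i Hi; unfold update; destruct (Nat.eqb_spec i j); [lia | reflexivity]. }
    exists (update e j a); split; [|split].
    - exact Hu.
    - refine (HN _ _ _ HA); intros i Hi; apply E; unfold j; lia.
    - refine (HN' _ _ _ Ha); intros [|i] Hi; simpl.
      + unfold update; rewrite Nat.eqb_refl; reflexivity.
      + apply E; unfold j; lia. }
  exists (Build_condition _ HS HL); split; [intros e [H _]; exact H|].
  exists j; intros e [_ H]; exact H.
Qed.

(** A semantic substitute for [IsSigma (S n)] that also covers negations of Pi formulas and
    conjunctions of Delta_0 formulas. *)
Definition definable_formula (p : formula) : Prop :=
  forall s, subst_map s -> Sg M (S n) (fun e => sat M (s e) p).

(** Names are supplied by a finite list, with name 0 as default, so that there are only countably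
    many instances to decide. *)
Definition list_env (l : list nat) (e : env) : env := fun i => e (nth i l 0).

Definition inst (p : formula) (l : list nat) (x : M) (e : env) : Prop :=
  sat M (scons x (list_env l e)) p.

Lemma inst_Sg p l : definable_formula p ->
  Sg M (S n) (fun e => inst p l (e 0) (tail e)).
Proof.
  intros Hp; apply (Hp (fun e => scons (e 0) (list_env l (tail e)))).
  apply subst_map_scons; intros i; left; exists (S (nth i l 0)); reflexivity.
Qed.

(** The negation of a Sigma_{n+1} statement need not be Sigma_{n+1}, so it cannot simply be added to
    a condition. Non-largeness replaces it: the negation then holds on [A] as soon as coordinate 0
    is big enough. *)
Definition decides_witness p l (A : env -> Prop) : Prop :=
  ~ large (fun e => A e /\ exists a, inst p l a e) \/
  exists j, forall e, A e -> inst p l (e j) e.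

Definition names (c : M) (A : env -> Prop) : Prop :=
  exists j, forall e, A e -> e j = c.

Definition decides_cut p l (a : M) (A : env -> Prop) : Prop :=
  (forall e, A e -> forall x, x ≺ a -> inst p l x e) \/
  exists b, b ≺ a /\ (forall e, A e -> forall x, x ≺ b -> inst p l x e) /\
    ~ large (fun e => A e /\ inst p l b e).

Lemma decides_witness_dense p l (A : condition) : definable_formula p ->
  exists A' : condition, (forall e, A' e -> A e) /\ decides_witness p l A'.
Proof.
  intros Hp; destruct (classic (large (fun e => A e /\ exists a, inst p l a e))) as [H|H].
  - destruct (henkin_extension A (fun e => inst p l (e 0) (tail e)) (inst_Sg p l Hp) H)
      as (A' & H1 & j & Hj).
    exists A'; split; [exact H1 | right; exists j; exact Hj].
  - exists A; split; [auto | left; exact H].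
Qed.

Lemma names_dense c (A : condition) :
  exists A' : condition, (forall e, A' e -> A e) /\ names c A'.
Proof.
  destruct (henkin_extension A (fun e => e 0 = c)) as (A' & H1 & j & Hj).
  - apply D0_Sg, (D0_sat M (feq (tvar 0) (tvar 1)) (fun e => scons (e 0) (fun _ => c))).
    + constructor.
    + apply subst_map_scons, subst_map_all.
  - refine (large_mono M A _ _ (cset_large A)); intros e He.
    split; [exact He | exists c; reflexivity].
  - exists A'; split; [exact H1 | exists j; exact Hj].
Qed.

Lemma decides_cut_dense p l a (A : condition) : definable_formula p ->
  exists A' : condition, (forall e, A' e -> A e) /\ decides_cut p l a A'.
Proof.
  intros Hp; pose proof (inst_Sg p l Hp) as HX.
  assert (HS : forall b, Sg M (S n) (fun e => A e /\ forall x, x ≺ b -> inst p l x e)).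
  { intros b; apply Sg_and; [apply A|].
    assert (H : Sg M (S n) (fun e => forall x, x ≺ e 0 -> inst p l x (tail e))).
    { apply (proj1 (Sg_bounded M HPA (S n) Hind (S n) (Nat.le_succ_diag_r _))
                (fun w => inst p l (w 0) (tail (tail w))) 0).
      apply (Sg_subst M (S n) _ (fun w => scons (w 0) (tail (tail w))) HX).
      apply subst_map_scons, (subst_map_vars M (fun i => S (S i))). }
    apply (Sg_subst M (S n) _ (fun e => scons b e) H), subst_map_const, subst_map_id. }
  destruct (large_cut A _ a (cset_Sg A) HX (cset_large A)) as [H|(b & Hb & H1 & H2)].
  - exists (Build_condition _ (HS a) H); split; [intros e [H' _]; exact H'|].
    left; intros e [_ H']; exact H'.
  - exists (Build_condition _ (HS b) H1); split; [intros e [H' _]; exact H'|].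
    right; exists b; split; [exact Hb | split; [intros e [_ H']; exact H'|]].
    (* If [inst p l b] held on a large part of the new condition, the bounded statement would still
       be large at b + 1. *)
    intros H3; apply H2; refine (large_mono M _ _ _ H3); intros e [[HA He] He'].
    split; [exact HA|]; intros x Hx.
    destruct (lt_succ_inv M HPA _ _ Hx) as [Hx'| ->]; [apply He, Hx' | exact He'].
Qed.

(** One index bundles three requirements; [c] is both the element to be named and the bound of the
    cut. All three persist when the set shrinks, so they can be met one after another. *)
Definition meets (i : formula * list nat * M) (A : env -> Prop) : Prop :=
  let '(p, l, c) := i in
  names c A /\
  (definable_formula p -> decides_witness p l A /\ decides_cut p l c A).

Lemma meets_dense i (A : condition) :
  exists A' : condition, (forall e, A' e -> A e) /\ meets i A'.
Proof.
  destruct i as [[p l] c].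
  destruct (names_dense c A) as (A1 & H1 & j & Hj).
  destruct (classic (definable_formula p)) as [Hp|Hp].
  - destruct (decides_witness_dense p l A1 Hp) as (A2 & H2 & HW).
    destruct (decides_cut_dense p l c A2 Hp) as (A3 & H3 & HC).
    exists A3; split; [auto | split; [exists j; auto | intros _; split; [|exact HC]]].
    destruct HW as [HW|(j' & HW)]; [left | right; exists j'; auto].
    intros H; apply HW; refine (large_mono M _ _ _ H); intros e [He H']; auto.
  - exists A1; split; [exact H1 | split; [exists j; exact Hj | contradiction]].
Qed.

(** What the construction of the model uses of the generic sequence. [T] is a proper filter on sets
    of assignments; in place of the ultrafilter property it is asked only to decide definable
    formulas. *)
Record generic_filter (T : (env -> Prop) -> Prop) : Prop := {
  gf_mono : forall Y Z : env -> Prop, (forall e, Y e -> Z e) -> T Y -> T Z;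
  gf_and : forall Y Z : env -> Prop, T Y -> T Z -> T (fun e => Y e /\ Z e);
  gf_proper : ~ T (fun _ => False);
  gf_above : forall u, T (fun e => u ≺ e 0);
  gf_names : forall c, exists j, T (fun e => e j = c);
  gf_witness : forall p l, definable_formula p ->
    T (fun e => ~ exists a, inst p l a e) \/ exists j, T (fun e => inst p l (e j) e);
  gf_cut : forall p l a, definable_formula p ->
    T (fun e => forall x, x ≺ a -> inst p l x e) \/
    exists b, b ≺ a /\ T (fun e => forall x, x ≺ b -> inst p l x e) /\
      T (fun e => ~ inst p l b e)
}.

Lemma generic_filter_exists (d : nat -> formula * list nat * M) :
  (forall i, exists k, d k = i) -> exists T, generic_filter T.
Proof.
  intros Hd.
  assert (S0 : Sg M (S n) (fun _ => True)).
  { apply D0_Sg; erewrite pred_ext;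
      [apply (D0_sat M (fnot fbot) (fun e => e)); [repeat constructor | apply subst_map_id]|].
    simpl; tauto. }
  assert (L0 : large (fun _ : env => True)).
  { intros u; exists (fun _ => sadd M u (sone M)); split; [apply lt_succ, HPA | exact I]. }
  pose (step k A := proj1_sig (constructive_indefinite_description _ (meets_dense (d k) A))).
  assert (Hstep : forall k A, (forall e, step k A e -> cset A e) /\ meets (d k) (step k A)).
  { intros k A; exact (proj2_sig (constructive_indefinite_description _ (meets_dense (d k) A))). }
  pose (G := fix G k := match k with
                        | 0 => Build_condition _ S0 L0
                        | S k => step k (G k)
                        end).
  assert (Gmono : forall s t, s <= t -> forall e, G t e -> G s e).
  { intros s t; induction 1 as [|t Hst IH]; intros e He; [exact He|].
    apply IH, (proj1 (Hstep t (G t))), He. }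
  assert (Gmeets : forall i, exists s, meets i (G s)).
  { intros i; destruct (Hd i) as [k <-]; exists (S k); apply Hstep. }
  (* Membership is tested on one condition of the sequence, and only where coordinate 0 exceeds some
     [u]; thus complements of sets that are not large on a condition belong to [T]. *)
  pose (T Y := exists s u, forall e, G s e -> u ≺ e 0 -> Y e).
  assert (Tin : forall s (Y : env -> Prop), (forall e, G s e -> Y e) -> T Y).
  { intros s Y H; exists s, (szero M); auto. }
  assert (Tout : forall s Y, ~ large (fun e => G s e /\ Y e) -> T (fun e => ~ Y e)).
  { intros s Y H; apply not_large in H; destruct H as [u Hu].
    exists s, u; intros e He Hue HY; exact (Hu e Hue (conj He HY)). }
  exists T; constructor.
  - intros Y Z H (s & u & HY); exists s, u; auto.
  - intros Y Z (s & u & HY) (t & v & HZ); destruct (upper_bound M HPA u v) as (w & Hu & Hv).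
    exists (s + t), w; intros e He Hw; split.
    + apply HY; [apply (Gmono s (s + t)); [lia | exact He]|].
      exact (lt_trans M HPA _ _ _ Hu Hw).
    + apply HZ; [apply (Gmono t (s + t)); [lia | exact He]|].
      exact (lt_trans M HPA _ _ _ Hv Hw).
  - intros (s & u & H); destruct (cset_large (G s) u) as (e & Hu & He); exact (H e He Hu).
  - intros u; exists 0, u; auto.
  - intros c; destruct (Gmeets (fbot, nil, c)) as [s [[j Hj] _]]; eauto.
  - intros p l Hp; destruct (Gmeets (p, l, szero M)) as [s [_ H]].
    destruct (H Hp) as [[H'|[j Hj]] _]; [left | right]; eauto.
  - intros p l a Hp; destruct (Gmeets (p, l, a)) as [s [_ H]].
    destruct (H Hp) as [_ [H'|(b & Hb & H1 & H2)]]; [left; eauto | right].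
    exists b; split; [exact Hb | split; eauto].
Qed.

End Generic.

(* Enumeration of the requirements *)
Opaque Cantor.to_nat.

Fixpoint term_code (t : term) : nat :=
  match t with
  | tvar i => Cantor.to_nat (0, i)
  | tzero => Cantor.to_nat (1, 0)
  | tone => Cantor.to_nat (2, 0)
  | tadd s u => Cantor.to_nat (3, Cantor.to_nat (term_code s, term_code u))
  | tmul s u => Cantor.to_nat (4, Cantor.to_nat (term_code s, term_code u))
  end.

Fixpoint formula_code (p : formula) : nat :=
  match p with
  | feq s t => Cantor.to_nat (0, Cantor.to_nat (term_code s, term_code t))
  | flt s t => Cantor.to_nat (1, Cantor.to_nat (term_code s, term_code t))
  | fbot => Cantor.to_nat (2, 0)
  | fnot q => Cantor.to_nat (3, formula_code q)
  | fand q r => Cantor.to_nat (4, Cantor.to_nat (formula_code q, formula_code r))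
  | forr q r => Cantor.to_nat (5, Cantor.to_nat (formula_code q, formula_code r))
  | fimp q r => Cantor.to_nat (6, Cantor.to_nat (formula_code q, formula_code r))
  | fall q => Cantor.to_nat (7, formula_code q)
  | fex q => Cantor.to_nat (8, formula_code q)
  | fball t q => Cantor.to_nat (9, Cantor.to_nat (term_code t, formula_code q))
  | fbex t q => Cantor.to_nat (10, Cantor.to_nat (term_code t, formula_code q))
  end.

Fixpoint list_code (l : list nat) : nat :=
  match l with
  | nil => 0
  | cons a l => S (Cantor.to_nat (a, list_code l))
  end.

Lemma to_nat_pair_inj a b c d :
  Cantor.to_nat (a, b) = Cantor.to_nat (c, d) -> a = c /\ b = d.
Proof. intros H; apply Cantor.to_nat_inj in H; injection H; auto. Qed.

Ltac decode_all :=
  repeat match goal with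
  | H : Cantor.to_nat _ = Cantor.to_nat _ |- _ => apply to_nat_pair_inj in H as [? ?]
  end.

Lemma term_code_inj s : forall t, term_code s = term_code t -> s = t.
Proof.
  induction s; intros [] H; simpl in H; decode_all; try discriminate; f_equal; auto.
Qed.

Lemma formula_code_inj p : forall q, formula_code p = formula_code q -> p = q.
Proof.
  induction p; intros [] H; simpl in H; decode_all; try discriminate;
    f_equal; auto using term_code_inj.
Qed.

Lemma list_code_inj l : forall l', list_code l = list_code l' -> l = l'.
Proof.
  induction l as [|a l IH]; intros [|b l'] H; simpl in H; try discriminate; auto.
  injection H as H; decode_all; f_equal; auto.
Qed.

Lemma surjection_of_injection {I : Type} (i0 : I) (c : I -> nat) :
  (forall i j, c i = c j -> i = j) -> exists d : nat -> I, forall i, exists k, d k = i.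
Proof.
  intros H; exists (fun k => epsilon (inhabits i0) (fun i => c i = k)).
  intros i; exists (c i); apply H, (epsilon_spec (inhabits i0) (fun j => c j = c i)).
  exists i; reflexivity.
Qed.

Lemma formula_list_countable (M : structure) : countable_structure M ->
  exists d : nat -> formula * list nat * M, forall i, exists k, d k = i.
Proof.
  intros [g Hg].
  destruct (surjection_of_injection (fbot, @nil nat, 0)
    (fun i => let '(p, l, k) := i in
       Cantor.to_nat (formula_code p, Cantor.to_nat (list_code l, k)))) as [d Hd].
  - intros [[p l] k] [[q l'] k'] H; decode_all.
    f_equal; [f_equal|]; auto using formula_code_inj, list_code_inj.
  - exists (fun k => let '(p, l, i) := d k in (p, l, g i)).
    intros [[p l] c]; destruct (Hg c) as [i Hi], (Hd (p, l, i)) as [k Hk].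
    exists k; rewrite Hk, Hi; reflexivity.
Qed.

(** * The model of names and its truth lemma *)

Section Quotient.

Context (M : structure) (n : nat) (HPA : PAminus M).
Context (T : ((nat -> M) -> Prop) -> Prop) (gf : generic_filter M n T).

Local Notation env := (nat -> dom M).
Local Notation "x ≺ y" := (slt M x y) (at level 70).

Lemma gf_and_mono (Y Z W : env -> Prop) :
  T Y -> T Z -> (forall e, Y e -> Z e -> W e) -> T W.
Proof.
  intros HY HZ H; refine (gf_mono _ _ _ gf _ _ _ (gf_and _ _ _ gf _ _ HY HZ)).
  intros e [H1 H2]; auto.
Qed.

Lemma gf_contra (Y Z : env -> Prop) :
  T Y -> T Z -> (forall e, Y e -> Z e -> False) -> False.
Proof. intros HY HZ H; exact (gf_proper _ _ _ gf (gf_and_mono _ _ _ HY HZ H)). Qed.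

Lemma gf_all (Y : env -> Prop) : (forall e, Y e) -> T Y.
Proof. intros H; refine (gf_mono _ _ _ gf _ _ _ (gf_above _ _ _ gf (szero M))); auto. Qed.

Lemma gf_const (P : Prop) : T (fun _ => P) -> P.
Proof.
  intros H; apply NNPP; intros H'; apply (gf_proper _ _ _ gf).
  exact (gf_mono _ _ _ gf _ _ (fun _ => H') H).
Qed.

Definition gclass (j : nat) : nat -> Prop := fun k => T (fun e => e j = e k).

(** [sat] reads equations as equality in the domain, so names that agree modulo [T] have to be
    identified; the elements are the equivalence classes themselves. *)
Definition qdom : Type := {S : nat -> Prop | exists j, S = gclass j}.

Definition cls (j : nat) : qdom := exist _ (gclass j) (ex_intro _ j eq_refl).

Definition rep (x : qdom) : nat :=
  proj1_sig (constructive_indefinite_description _ (proj2_sig x)).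

Lemma cls_eq j k : T (fun e => e j = e k) -> cls j = cls k.
Proof.
  intros H; apply eq_sig_hprop; [intros; apply proof_irrelevance|]; simpl.
  apply pred_ext; intros i; split; intros H'; apply (gf_and_mono _ _ _ H H');
    intros e; congruence.
Qed.

Lemma cls_rep x : cls (rep x) = x.
Proof.
  apply eq_sig_hprop; [intros; apply proof_irrelevance|]; simpl.
  symmetry; exact (proj2_sig (constructive_indefinite_description _ (proj2_sig x))).
Qed.

Lemma rep_cls j : T (fun e => e (rep (cls j)) = e j).
Proof.
  change (gclass (rep (cls j)) j).
  change (gclass (rep (cls j))) with (proj1_sig (cls (rep (cls j)))).
  rewrite cls_rep; apply gf_all; reflexivity.
Qed.

Lemma rep_eq x y : T (fun e => e (rep x) = e (rep y)) -> x = y.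
Proof. intros H; rewrite <- (cls_rep x), <- (cls_rep y); apply cls_eq, H. Qed.

(** A function of the assignment acts like an element of a reduced power, and a name for it modulo
    [T] is chosen. If there is none the choice is arbitrary; [rep_named] and [term_named] show that
    the functions used in [quotient] do have names. *)
Definition named (c : env -> M) : qdom :=
  cls (epsilon (inhabits 0) (fun j => T (fun e => e j = c e))).

Lemma named_spec c : (exists j, T (fun e => e j = c e)) ->
  T (fun e => e (rep (named c)) = c e).
Proof.
  intros H; apply (epsilon_spec (inhabits 0)) in H.
  unfold named; set (j := epsilon _ _) in *; clearbody j.
  apply (gf_and_mono _ _ _ (rep_cls j) H); congruence.
Qed.

Definition quotient : structure := {|
  dom := qdom;
  szero := named (fun _ => szero M);
  sone := named (fun _ => sone M);
  sadd := fun x y => named (fun e => sadd M (e (rep x)) (e (rep y)));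
  smul := fun x y => named (fun e => smul M (e (rep x)) (e (rep y)));
  slt := fun x y => T (fun e => e (rep x) ≺ e (rep y))
|}.

Local Notation K := quotient.

(** This reads the names held by [eK] under the assignment [e]. That a formula p is forced at [eK]
    is then expressed by [T (fun e => sat M (hat eK e) p)]. *)
Definition hat (eK : nat -> K) (e : env) : env := fun i => e (rep (eK i)).

Lemma hat_scons (x : K) eK e : hat (scons x eK) e = scons (e (rep x)) (hat eK e).
Proof. extensionality i; destruct i; reflexivity. Qed.

Lemma inst_hat p (eK : nat -> K) :
  exists l, forall a e, inst M p l a e = sat M (scons a (hat eK e)) p.
Proof.
  destruct (sat_support p) as [N HN].
  exists (map (fun i => rep (eK i)) (seq 0 N)); intros a e; apply HN.
  apply scons_agree; intros i Hi; unfold list_env, hat; f_equal.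
  rewrite (nth_indep _ 0 (rep (eK 0))) by (rewrite length_map, length_seq; exact Hi).
  rewrite (map_nth (fun i => rep (eK i))), seq_nth by exact Hi; reflexivity.
Qed.

Lemma quotient_witness p (eK : nat -> K) : definable_formula M n p ->
  T (fun e => ~ exists a, sat M (scons a (hat eK e)) p) \/
  exists x : K, T (fun e => sat M (hat (scons x eK) e) p).
Proof.
  intros Hp; destruct (inst_hat p eK) as [l Hl].
  destruct (gf_witness _ _ _ gf p l Hp) as [H|[j Hj]]; [left | right].
  - refine (gf_mono _ _ _ gf _ _ _ H); intros e H' [a Ha]; apply H'; exists a.
    rewrite Hl; exact Ha.
  - exists (cls j); apply (gf_and_mono _ _ _ (rep_cls j) Hj); intros e E H.
    rewrite hat_scons, E, <- Hl; exact H.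
Qed.

(** The witness requirement is applied with a vacuous quantifier: [ren S p] does not mention
    variable 0. *)
Lemma quotient_decides p (eK : nat -> K) : definable_formula M n p ->
  T (fun e => sat M (hat eK e) p) \/ T (fun e => ~ sat M (hat eK e) p).
Proof.
  intros Hp; destruct (quotient_witness (ren S p) eK) as [H|[x Hx]]; [|right|left].
  - intros s Hs; erewrite pred_ext; [apply (Hp (fun e i => s e (S i)))|].
    + intros i; apply Hs.
    + intros e; rewrite sat_ren; reflexivity.
  - refine (gf_mono _ _ _ gf _ _ _ H); intros e H' He; apply H'; exists (szero M).
    rewrite sat_ren; exact He.
  - refine (gf_mono _ _ _ gf _ _ _ Hx); intros e; rewrite sat_ren; auto.
Qed.

Lemma Delta0_definable p : Delta0 p -> definable_formula M n p.
Proof. intros Hp s Hs; apply D0_Sg, D0_sat; assumption. Qed.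

Lemma rep_named c : T (fun e => e (rep (named (fun _ => c))) = c).
Proof. apply named_spec, (gf_names _ _ _ gf). Qed.

(** The witness requirement for the equation x = t gives a name, since its negative alternative
    would put the empty set in [T]. *)
Lemma term_named (t : term) (eK : nat -> K) :
  T (fun e => e (rep (named (fun e => eval M (hat eK e) t))) = eval M (hat eK e) t).
Proof.
  apply named_spec.
  destruct (quotient_witness (feq (tvar 0) (tren S t)) eK) as [H|[x Hx]].
  - apply Delta0_definable; constructor.
  - exfalso; apply (gf_proper _ _ _ gf); refine (gf_mono _ _ _ gf _ _ _ H).
    intros e H'; apply H'; exists (eval M (hat eK e) t); simpl.
    rewrite eval_tren; reflexivity.
  - exists (rep x); refine (gf_mono _ _ _ gf _ _ _ Hx); intros e; simpl.
    rewrite eval_tren; auto.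
Qed.

Lemma rep_add (x y : K) :
  T (fun e => e (rep (sadd K x y)) = sadd M (e (rep x)) (e (rep y))).
Proof. exact (term_named (tadd (tvar 0) (tvar 1)) (scons x (fun _ => y))). Qed.

Lemma rep_mul (x y : K) :
  T (fun e => e (rep (smul K x y)) = smul M (e (rep x)) (e (rep y))).
Proof. exact (term_named (tmul (tvar 0) (tvar 1)) (scons x (fun _ => y))). Qed.

Lemma rep_eval t (eK : nat -> K) :
  T (fun e => e (rep (eval K eK t)) = eval M (hat eK e) t).
Proof.
  induction t as [i| | |s IHs u IHu|s IHs u IHu].
  - apply gf_all; reflexivity.
  - exact (rep_named (szero M)).
  - exact (rep_named (sone M)).
  - apply (gf_and_mono _ _ _ (rep_add (eval K eK s) (eval K eK u))
      (gf_and _ _ _ gf _ _ IHs IHu)).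
    intros e E [Es Eu]; simpl in *; congruence.
  - apply (gf_and_mono _ _ _ (rep_mul (eval K eK s) (eval K eK u))
      (gf_and _ _ _ gf _ _ IHs IHu)).
    intros e E [Es Eu]; simpl in *; congruence.
Qed.

(* The two halves of the truth lemma are kept apart: for Sigma_{m+1} and Pi_{m+1}
   formulas only one of them holds. *)
Definition true_of_forced (p : formula) : Prop := forall eK : nat -> K,
  T (fun e => sat M (hat eK e) p) -> sat K eK p.

Definition false_of_forced (p : formula) : Prop := forall eK : nat -> K,
  T (fun e => ~ sat M (hat eK e) p) -> ~ sat K eK p.

Lemma bounded_witness p t (eK : nat -> K) : Delta0 p ->
  T (fun e => exists a, a ≺ eval M (hat eK e) t /\ sat M (scons a (hat eK e)) p) ->
  exists x : K, slt K x (eval K eK t) /\ T (fun e => sat M (hat (scons x eK) e) p).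
Proof.
  intros Hp H; destruct (quotient_witness (fand (flt (tvar 0) (tren S t)) p) eK)
    as [H'|[x Hx]].
  - apply Delta0_definable; auto using Delta0.
  - destruct (gf_contra _ _ H H').
    intros e (a & Ha & He) He'; apply He'; exists a; simpl; rewrite eval_tren; auto.
  - exists x; split.
    + apply (gf_and_mono _ _ _ Hx (rep_eval t eK)); intros e [H1 _] E.
      simpl in H1; rewrite eval_tren in H1; rewrite E; exact H1.
    + refine (gf_mono _ _ _ gf _ _ _ Hx); intros e [_ H2]; exact H2.
Qed.

Lemma lt_eval (x : K) t eK : slt K x (eval K eK t) ->
  T (fun e => e (rep x) ≺ eval M (hat eK e) t).
Proof.
  intros H; apply (gf_and_mono _ _ _ H (rep_eval t eK)); intros e H' <-; exact H'.
Qed.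

(** Negation exchanges the two halves. Where a filter alone does not suffice, as for disjunctions
    and refuted conjunctions, a subformula is first decided by [quotient_decides]; bounded witnesses
    come from [bounded_witness]. *)
Lemma Delta0_truth p : Delta0 p -> true_of_forced p /\ false_of_forced p.
Proof.
  induction 1 as [s t|s t| |p Hp [P N]|p q Hp [P N] Hq [P' N']|p q Hp [P N] Hq [P' N']
                 |p q Hp [P N] Hq [P' N']|t p Hp [P N]|t p Hp [P N]]; split; intros eK H; simpl.
  - apply rep_eq.
    apply (gf_and_mono _ _ _ H (gf_and _ _ _ gf _ _ (rep_eval s eK) (rep_eval t eK))).
    simpl; intros e E [Es Et]; congruence.
  - intros E; apply (gf_contra _ _ H (gf_and _ _ _ gf _ _ (rep_eval s eK) (rep_eval t eK))).
    simpl; intros e E' [Es Et]; apply E'; congruence.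
  - apply (gf_and_mono _ _ _ H (gf_and _ _ _ gf _ _ (rep_eval s eK) (rep_eval t eK))).
    simpl; intros e E [Es Et]; congruence.
  - intros E; apply (gf_contra _ _ (gf_and _ _ _ gf _ _ H E)
      (gf_and _ _ _ gf _ _ (rep_eval s eK) (rep_eval t eK))).
    simpl; intros e [E' E2] [Es Et]; apply E'; congruence.
  - exact (gf_proper _ _ _ gf H).
  - auto.
  - apply N, H.
  - intros H'; apply H', P; refine (gf_mono _ _ _ gf _ _ _ H); intros e; apply NNPP.
  - split; [apply P | apply P']; refine (gf_mono _ _ _ gf _ _ _ H); intros e [? ?]; assumption.
  - intros [H1 H2]; destruct (quotient_decides p eK (Delta0_definable p Hp)) as [D|D];
      [|exact (N _ D H1)].
    refine (N' _ (gf_and_mono _ _ _ H D _) H2); intros e; simpl; tauto.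
  - destruct (quotient_decides p eK (Delta0_definable p Hp)) as [D|D]; [left; auto | right].
    apply P', (gf_and_mono _ _ _ H D); intros e; simpl; tauto.
  - intros [H'|H']; [refine (N _ _ H') | refine (N' _ _ H')];
      refine (gf_mono _ _ _ gf _ _ _ H); intros e; simpl; tauto.
  - intros H'; destruct (quotient_decides p eK (Delta0_definable p Hp)) as [D|D];
      [|destruct (N _ D H')].
    apply P', (gf_and_mono _ _ _ H D); simpl; auto.
  - intros H'; refine (N' eK _ (H' (P eK _))); refine (gf_mono _ _ _ gf _ _ _ H);
      intros e; simpl; tauto.
  - intros x Hx; apply P, (gf_and_mono _ _ _ H (lt_eval x t eK Hx)).
    intros e H1 H2; rewrite hat_scons; exact (H1 _ H2).
  - intros H'; destruct (bounded_witness (fnot p) t eK) as (x & Hx & Hx').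
    + auto using Delta0.
    + refine (gf_mono _ _ _ gf _ _ _ H); simpl; intros e He; apply NNPP; intros He'.
      apply He; intros a Ha; apply NNPP; eauto.
    + exact (N _ Hx' (H' x Hx)).
  - destruct (bounded_witness p t eK Hp H) as (x & Hx & Hx'); exists x; auto.
  - intros (x & Hx & Hx'); refine (N _ (gf_and_mono _ _ _ H (lt_eval x t eK Hx) _) Hx').
    intros e H1 H2 H3; apply H1; rewrite hat_scons in H3; simpl; eauto.
Qed.

Lemma IsSigma_definable k p : IsSigma k p -> k <= S n -> definable_formula M n p.
Proof.
  intros Hp Hk s Hs; apply (Sg_le M k _ _ Hk), Sg_of_formula; assumption.
Qed.

Lemma IsPi_not_definable k p : IsPi k p -> k <= S n -> definable_formula M n (fnot p).
Proof.
  intros Hp Hk s Hs; apply (Sg_le M k _ _ Hk), Sg_of_formula; assumption.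
Qed.

(** Making a forced existential statement true takes a witness, which is available up to level n+1
    only. Refuting one just passes the refutation on to every instance, so this half reaches level
    n+2. For Pi formulas the roles are reversed. *)
Lemma truth_lemma :
  (forall k p, IsSigma k p ->
     (k <= S n -> true_of_forced p) /\ (k <= S (S n) -> false_of_forced p)) /\
  (forall k p, IsPi k p ->
     (k <= S (S n) -> true_of_forced p) /\ (k <= S n -> false_of_forced p)).
Proof.
  apply IsSigma_IsPi_ind.
  - intros k p Hp; split; intros _; apply Delta0_truth, Hp.
  - intros k p Hp [IHt IHf]; split; intros Hk; [apply IHt | apply IHf]; lia.
  - intros k p Hp [IHt IHf]; split; intros Hk eK H; simpl.
    + destruct (quotient_witness p eK (IsSigma_definable _ _ Hp Hk)) as [H'|[x Hx]].
      * destruct (gf_contra _ _ H H'); intros e; simpl; tauto.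
      * exists x; apply (IHt Hk), Hx.
    + intros [x Hx]; refine (IHf Hk _ _ Hx); refine (gf_mono _ _ _ gf _ _ _ H).
      intros e He He'; rewrite hat_scons in He'; apply He; simpl; eauto.
  - intros k p Hp; split; intros _; apply Delta0_truth, Hp.
  - intros k p Hp [IHt IHf]; split; intros Hk; [apply IHt | apply IHf]; lia.
  - intros k p Hp [IHt IHf]; split; intros Hk eK H; simpl.
    + intros x; apply (IHt Hk); refine (gf_mono _ _ _ gf _ _ _ H).
      intros e He; rewrite hat_scons; apply He.
    + intros H'.
      destruct (quotient_witness (fnot p) eK (IsPi_not_definable _ _ Hp Hk)) as [H1|[x Hx]].
      * apply (gf_contra _ _ H H1); simpl; intros e He He'; apply He; intros a.
        apply NNPP; eauto.
      * exact (IHf Hk _ Hx (H' x)).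
Qed.

(** * The embedding of [M] and the properties of the extension *)

Definition embed (c : M) : K := named (fun _ => c).

(** [T] is closed under finite intersections, and only the finitely many variables in the support of
    [p] have to be read correctly. *)
Lemma hat_embed p (e : env) :
  T (fun v => sat M (hat (fun i => embed (e i)) v) p = sat M e p).
Proof.
  destruct (sat_support p) as [N HN].
  assert (H : T (fun v => forall i, i < N -> hat (fun i => embed (e i)) v i = e i)).
  { clear HN; induction N as [|N IH]; [apply gf_all; intros; lia|].
    apply (gf_and_mono _ _ _ IH (rep_named (e N))); intros v H H' i Hi.
    destruct (Nat.eq_dec i N) as [->|Hn]; [exact H' | apply H; lia]. }
  refine (gf_mono _ _ _ gf _ _ _ H); intros v; apply HN.
Qed.

(** Upwards, the leading existential block is witnessed in [M], and its Pi_{n+1} matrix is forced,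
    hence true. Downwards, a formula false in [M] is forced to be false, and [false_of_forced] is
    available for Sigma_{n+2}. *)
Lemma quotient_sigma_elementary : sigma_elementary (S (S n)) M K embed.
Proof.
  intros p Hp e; destruct truth_lemma as [TS TP].
  split; intros H.
  - revert e H; remember (S (S n)) as k eqn:Ek; induction Hp as [k p Hp|k p Hp|k p Hp IH];
      intros e H.
    + apply (proj1 (Delta0_truth p Hp)); refine (gf_mono _ _ _ gf _ _ _ (hat_embed p e)).
      intros v E; rewrite E; exact H.
    + apply (proj1 (TP k p Hp)); [lia|].
      refine (gf_mono _ _ _ gf _ _ _ (hat_embed p e)); intros v E; rewrite E; exact H.
    + destruct H as [a Ha]; specialize (IH Ek TS TP _ Ha); exists (embed a).
      replace (scons (embed a) (fun i => embed (e i)))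
        with (fun i => embed (scons a e i)); [exact IH|].
      extensionality i; destruct i; reflexivity.
  - apply NNPP; intros H'; refine (proj2 (TS _ p Hp) (le_n _) _ _ H).
    refine (gf_mono _ _ _ gf _ _ _ (hat_embed p e)); intros v E; rewrite E; exact H'.
Qed.

Lemma quotient_embedding : embedding M K embed.
Proof.
  split; [|split; [|split; [|split; [|split]]]].
  - intros a b H; apply gf_const; unfold embed in H.
    pose proof (rep_named a) as Ha; rewrite H in Ha.
    apply (gf_and_mono _ _ _ Ha (rep_named b)); congruence.
  - reflexivity.
  - reflexivity.
  - intros a b; apply rep_eq, (gf_and_mono _ _ _ (rep_named (sadd M a b))
      (gf_and _ _ _ gf _ _ (rep_add (embed a) (embed b))
         (gf_and _ _ _ gf _ _ (rep_named a) (rep_named b)))).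
    unfold embed; intros e E [E' [E1 E2]]; congruence.
  - intros a b; apply rep_eq, (gf_and_mono _ _ _ (rep_named (smul M a b))
      (gf_and _ _ _ gf _ _ (rep_mul (embed a) (embed b))
         (gf_and _ _ _ gf _ _ (rep_named a) (rep_named b)))).
    unfold embed; intros e E [E' [E1 E2]]; congruence.
  - intros a b; pose proof (gf_and _ _ _ gf _ _ (rep_named a) (rep_named b)) as H; split.
    + intros Hab; refine (gf_mono _ _ _ gf _ _ _ H); unfold embed; intros e [-> ->]; exact Hab.
    + intros Hab; apply gf_const; apply (gf_and_mono _ _ _ H Hab).
      unfold embed; intros e [-> ->]; auto.
Qed.

Lemma quotient_proper : proper_ext M K embed.
Proof.
  exists (cls 0); intros m E.
  apply (gf_contra _ _ (gf_above _ _ _ gf m)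
    (gf_and _ _ _ gf _ _ (rep_named m) (rep_cls 0))).
  rewrite <- E; unfold embed; intros e H [H1 H2]; apply (lt_irrefl M HPA m); congruence.
Qed.

Lemma quotient_cut p (eK : nat -> K) a : definable_formula M n p ->
  T (fun e => forall x, x ≺ a -> sat M (scons x (hat eK e)) p) \/
  exists b, b ≺ a /\ T (fun e => forall x, x ≺ b -> sat M (scons x (hat eK e)) p) /\
    T (fun e => ~ sat M (scons b (hat eK e)) p).
Proof.
  intros Hp; destruct (inst_hat p eK) as [l Hl].
  destruct (gf_cut _ _ _ gf p l a Hp) as [H|(b & Hb & H1 & H2)]; [left | right].
  - refine (gf_mono _ _ _ gf _ _ _ H); intros e He x Hx; rewrite <- Hl; auto.
  - exists b; split; [exact Hb|]; split.
    + refine (gf_mono _ _ _ gf _ _ _ H1); intros e He x Hx; rewrite <- Hl; auto.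
    + refine (gf_mono _ _ _ gf _ _ _ H2); intros e He; rewrite <- Hl; auto.
Qed.

Lemma quotient_end_ext : end_ext M K embed.
Proof.
  intros k Hk m.
  (* With the bound m + 1 the first alternative includes [m] itself being below [k]. In the second,
     everything below [b] is below [k] but [b] is not, so [k] equals [b]. *)
  destruct (quotient_cut (flt (tvar 0) (tvar 1)) (fun _ => k) (sadd M m (sone M)))
    as [H|(b & Hb & H1 & H2)].
  - apply Delta0_definable; constructor.
  - apply (gf_and_mono _ _ _ H (rep_named m)); unfold embed; intros e He ->.
    apply (He m), (lt_succ M HPA).
  - destruct (Hk b); apply rep_eq.
    apply (gf_and_mono _ _ _ (gf_and _ _ _ gf _ _ H1 H2) (rep_named b)).
    unfold embed; intros e [He1 He2] ->; unfold hat in He1, He2; simpl in He1, He2.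
    destruct (lt_trichotomy M HPA b (e (rep k))) as [H|[H|H]]; [contradiction | exact H|].
    destruct (lt_irrefl M HPA _ (He1 _ H)).
Qed.

Lemma quotient_M_ISigma : M_ISigma (S n) M K embed.
Proof.
  intros p Hp eK a H0 HS x Hx; destruct truth_lemma as [TS _].
  destruct (TS _ p Hp) as [Ht Hf]; specialize (Ht (le_n _)).
  specialize (Hf (Nat.le_succ_diag_r _)).
  destruct (quotient_cut p eK a (IsSigma_definable _ _ Hp (le_n _))) as [H|(b & Hb & H1 & H2)].
  - apply Ht, (gf_and_mono _ _ _ H (gf_and _ _ _ gf _ _ (rep_named a) Hx)).
    unfold embed; intros e He [E He']; rewrite E in He'; rewrite hat_scons; apply He, He'.
  - exfalso.
    assert (HN : ~ sat K (scons (embed b) eK) p).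
    { apply Hf, (gf_and_mono _ _ _ H2 (rep_named b)); intros e He E.
      rewrite hat_scons; unfold embed; rewrite E; exact He. }
    (* The cut [b] is not 0, where [p] holds by assumption. Its predecessor [c] lies below [b], so
       [p] is true there, and the induction step at [c], which is below [a], makes [p] true at
       [b]. *)
    destruct (zero_or_succ M HPA b) as [->|[c ->]]; [exact (HN H0)|].
    destruct quotient_embedding as (_ & _ & E1 & Eadd & _ & Elt).
    apply HN; rewrite Eadd, E1; apply HS.
    + apply Elt; exact (lt_trans M HPA _ _ _ (lt_succ M HPA c) Hb).
    + apply Ht, (gf_and_mono _ _ _ H1 (rep_named c)); intros e He E.
      rewrite hat_scons; unfold embed; rewrite E; apply He, (lt_succ M HPA).
Qed.

End Quotient.

Theorem theorem4p7 :
  forall (n : nat) (M : structure),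
    countable_structure M -> ISigma (S (S n)) M ->
    exists (K : structure) (f : M -> K),
      embedding M K f /\ end_ext M K f /\ proper_ext M K f /\
      sigma_elementary (S (S n)) M K f /\
      M_ISigma (S n) M K f.
Proof.
  intros n M HM [HPA Hind].
  destruct (formula_list_countable M HM) as [d Hd].
  destruct (generic_filter_exists M n HPA Hind d Hd) as [T gf].
  exists (quotient M T), (embed M T); split; [|split; [|split; [|split]]].
  - exact (quotient_embedding M n T gf).
  - exact (quotient_end_ext M n HPA T gf).
  - exact (quotient_proper M n HPA T gf).
  - exact (quotient_sigma_elementary M n T gf).
  - exact (quotient_M_ISigma M n HPA T gf).
Qed.
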